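(* Let $O$ be an interior point of a nondegenerate triangle $ABC$ in the Euclidean plane. The following are equivalent: (i) $O$ is the incenter of $ABC$; (ii) the direction from $O$ to a point uniformly distributed (with respect to area) in the interior of $ABC$ has the same distribution as the direction from $O$ to a point of the boundary of $ABC$ chosen uniformly by arclength.
   Context: The direction from $O$ to a point $Y\neq O$ is the unit vector $\operatorname{dir}_O(Y)=\dfrac{Y-O}{|Y-O|}$. (A uniformly distributed interior point equals $O$ with probability zero.) *)

(* Defs.v *)
From HB Require Import structures.
From mathcomp Require Import all_boot all_order all_algebra.
From mathcomp Require Import all_classical all_reals all_analysis.
From mathcomp Require Import measurable_realfun lra.

Set Implicit Arguments.
Unset Strict Implicit.
Unset Printing Implicit Defensive.
Import Order.TTheory GRing.Theory Num.Theory.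
Import numFieldNormedType.Exports.
Local Open Scope classical_set_scope.
Local Open Scope ring_scope.

Notation plane R := (measurableTypeR R * measurableTypeR R)%type.

Section Geometry.
Variable R : realType.
Implicit Types A B C O P Q T Y : plane R.

(* The library norm `|Y| on a product is the sup norm, so the Euclidean norm
   is written out; the product topology is the Euclidean one. *)
Definition enorm Y : R := Num.sqrt (Y.1 ^+ 2 + Y.2 ^+ 2).

(* dir O O = 0, as 0^-1 = 0; the direction is not meaningful there. *)
Definition dir O Y : plane R := (enorm (Y - O))^-1 *: (Y - O).

Definition line P Q : set (plane R) :=
  [set Y | exists t : R, Y = (1 - t) *: P + t *: Q].

Definition segment P Q : set (plane R) :=
  [set Y | exists t : R, 0 <= t <= 1 /\ Y = (1 - t) *: P + t *: Q].

Definition collinear A B C : Prop :=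
  exists P Q, [/\ line P Q A, line P Q B & line P Q C].

Definition triangle A B C : set (plane R) :=
  [set Y | exists a b c : R, [/\ 0 <= a, 0 <= b, 0 <= c, a + b + c = 1 &
                                 Y = a *: A + b *: B + c *: C]].

Definition circle O (r : R) : set (plane R) := [set Y | enorm (Y - O) = r].

(* The circle is tangent to the line PQ, at a point of the side PQ
   (as opposed to a point of its extension, as for excircles). *)
Definition touches_side O (r : R) P Q : Prop :=
  exists T, circle O r `&` line P Q = [set T] /\ segment P Q T.

Definition is_incircle A B C O (r : R) : Prop :=
  [/\ 0 < r, touches_side O r A B, touches_side O r B C & touches_side O r C A].

Definition is_incenter A B C O : Prop := exists r, is_incircle A B C O r.

Lemma measurable_dir O : measurable_fun [set: plane R] (dir O).
Proof.
have mB (i : plane R -> R) : measurable_fun [set: plane R] i ->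
    forall c, measurable_fun [set: plane R] (fun Y : plane R => i Y - c).
  by move=> mi c; apply: measurable_funB.
have m1 := mB _ measurable_fst O.1.
have m2 := mB _ measurable_snd O.2.
have mV : measurable_fun [set: plane R] (fun Y : plane R => (enorm (Y - O))^-1).
  pose q (Y : plane R) : R := (Y.1 - O.1) ^+ 2 + (Y.2 - O.2) ^+ 2.
  have -> : (fun Y : plane R => (enorm (Y - O))^-1) =
      (@powR R ^~ (-1)) \o ((@powR R ^~ 2^-1) \o q).
    apply/funext => Y /=.
    by rewrite powR12_sqrt ?addr_ge0 ?sqr_ge0// powR_inv1 ?sqrtr_ge0.
  apply: measurableT_comp; first exact: measurable_powR.
  apply: measurableT_comp; first exact: measurable_powR.
  by apply: measurable_funD; apply: measurable_funX.
by apply/measurable_fun_pairP; split; apply: measurable_funM.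
Qed.

Lemma open_measurable_plane (U : set (plane R)) : open U -> measurable U.
Proof.
move=> oU.
pose D := (rat * rat * (rat * rat))%type.
pose box (q : D) : set (plane R) :=
  [set` `]ratr q.1.1 : R, ratr q.1.2[] `*` [set` `]ratr q.2.1 : R, ratr q.2.2[].
have -> : U = \bigcup_q (if `[< box q `<=` U >] then box q else set0).
  apply/seteqP; split; last first.
    by move=> Y [q _]; case: asboolP => // qU /qU.
  move=> Y UY.
  have [[V W] /= [nV nW] VWU] := open_nbhs_nbhs (conj oU UY).
  have [e1 /= e10 V1] := nV; have [e2 /= e20 W2] := nW.
  have itv (x e : R) : 0 < e -> exists a b : rat,
      [/\ x - e < ratr a, ratr a < x, x < ratr b & ratr b < x + e].
    move=> e0.
    have [|a] := @rat_in_itvoo R (x - e) x; first by rewrite ltrBlDr ltrDl.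
    rewrite in_itv/= => /andP[? ?].
    have [|b] := @rat_in_itvoo R x (x + e); first by rewrite ltrDl.
    by rewrite in_itv/= => /andP[? ?]; exists a, b.
  have [a1 [b1 [? ? ? ?]]] := itv Y.1 e1 e10.
  have [a2 [b2 [? ? ? ?]]] := itv Y.2 e2 e20.
  exists ((a1, b1), (a2, b2)) => //; case: asboolP.
    by move=> _; split; rewrite /= in_itv/=; apply/andP.
  move=> nb; exfalso; apply: nb => -[z1 z2] [/=]; rewrite !in_itv/= => /andP[? ?] /andP[? ?].
  apply: VWU; split => /=.
    by apply: V1 => /=; rewrite ltr_distlC; apply/andP; split; lra.
  by apply: W2 => /=; rewrite ltr_distlC; apply/andP; split; lra.
apply: countable_bigcupT_measurable => [|q]; first exact: countableP.
case: ifP => // _.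
by apply: measurableX; exact: measurable_itv.
Qed.

HB.instance Definition _ O :=
  isMeasurableFun.Build _ _ _ _ (dir O) (measurable_dir O).

Definition area : {measure set (plane R) -> \bar R} :=
  (@lebesgue_measure R \x @lebesgue_measure R)%E.

Lemma measurable_interior_triangle A B C : measurable (triangle A B C)°.
Proof. exact: open_measurable_plane (@open_interior _ _). Qed.

(* The second argument of mnormalize is only used when the total mass is 0 or
   +oo, which never happens for a nondegenerate triangle. *)
Definition uniform_interior A B C : probability (plane R) R :=
  mnormalize (mrestr area (measurable_interior_triangle A B C)) (dirac A).

Definition unit_speed P Q (s : measurableTypeR R) : plane R := P + s *: dir P Q.

Lemma measurable_unit_speed P Q :
  measurable_fun [set: measurableTypeR R] (unit_speed P Q).
Proof.
by apply/measurable_fun_pairP; split => /=; apply: measurable_funD => //;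
  apply: measurable_funM.
Qed.

HB.instance Definition _ P Q :=
  isMeasurableFun.Build _ _ _ _ (unit_speed P Q) (measurable_unit_speed P Q).

Definition arclength_side P Q : set (plane R) -> \bar R :=
  pushforward
    (mrestr (@lebesgue_measure R) (measurable_itv `[0, enorm (Q - P)]))
    (unit_speed P Q).

Let arclength_side0 P Q : arclength_side P Q set0 = 0%E.
Proof. exact: measure0. Qed.

Let arclength_side_ge0 P Q U : (0 <= arclength_side P Q U)%E.
Proof. exact: measure_ge0. Qed.

Let arclength_side_sigma_additive P Q : semi_sigma_additive (arclength_side P Q).
Proof. exact: measure_semi_sigma_additive. Qed.

HB.instance Definition _ P Q := isMeasure.Build _ _ _ (arclength_side P Q)
  (arclength_side0 P Q) (@arclength_side_ge0 P Q)
  (@arclength_side_sigma_additive P Q).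

Definition arclength_boundary A B C : {measure set (plane R) -> \bar R} :=
  measure_add (measure_add (arclength_side A B) (arclength_side B C))
    (arclength_side C A).

Definition uniform_boundary A B C : probability (plane R) R :=
  mnormalize (arclength_boundary A B C) (dirac A).

End Geometry.

(* Main.v *)
(* Seen from [O], the triangle splits into the cones over its three sides.  In
   the cone over a side [PQ], with coordinates
   [O + x (P - O) + y (Q - P)], [0 <= y < x < 1], the direction depends only on
   [s = y / x], so Fubini gives that the direction of area measure is
   [|det (P - O, Q - O)| / 2] times the distribution of the direction of
   [P + s (Q - P)] for [s] uniform in [[0, 1[], while the direction of arclength
   is [|PQ|] times the same distribution.  Hence both laws are averages of the
   same three mutually singular laws, and they agree iff the weights are
   proportional, i.e. iff [O] is at the same distance from the three lines [PQ].
   For an interior point this means that it is the incenter. *)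
Require Import Defs.
From HB Require Import structures.
From mathcomp Require Import all_boot all_order all_algebra.
From mathcomp Require Import all_classical all_reals all_analysis.
From mathcomp Require Import measurable_realfun ring lra.
Set Implicit Arguments.
Unset Strict Implicit.
Unset Printing Implicit Defensive.
Import Order.TTheory GRing.Theory Num.Theory.
Import numFieldNormedType.Exports.
Local Open Scope classical_set_scope.
Local Open Scope ring_scope.

(** * Affine changes of variables *)

Section AffineMeasure.
Variable R : realType.
Local Notation mu := (@lebesgue_measure R).

Lemma measurable_affine (a b : R) :
  measurable_fun setT ((fun x => a * x + b) : measurableTypeR R -> measurableTypeR R).
Proof. by apply: measurable_funD => //; apply: measurable_funM. Qed.

(** By uniqueness of Lebesgue measure: its image under the affine map, rescaled by [|a|], gives
    half-open intervals their length. *)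
Lemma lebesgue_measure_affine (a b : R) (U : set (measurableTypeR R)) :
  a != 0 -> measurable U ->
  mu ((fun x => a * x + b) @^-1` U) = (`|a|^-1%:E * mu U)%E.
Proof.
move=> a0 mU.
pose f : measurableTypeR R -> measurableTypeR R := fun x => a * x + b.
have mf : measurable_fun setT f by exact: measurable_affine.
have na : 0 < `|a| by rewrite normr_gt0.
pose g : {mfun measurableTypeR R >-> measurableTypeR R} :=
  HB.pack f (isMeasurableFun.Build _ _ _ _ f mf).
pose k : {nonneg R} := NngNum (ltW na).
have E : mu U = (`|a|%:E * mu (f @^-1` U))%E.
  apply: (@lebesgue_measure_unique _ (mscale k (pushforward mu g))) => //.
  move=> _ [[x y]] _ <-.
  (* A negative [a] reverses the interval, so the preimage of []x, y]] is closed on the left instead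
     of on the right. *)
  transitivity (`|a|%:E * mu
     (if (0 < a)%R then [set` `](x - b) / a, (y - b) / a]%R]
      else [set` `[(y - b) / a, (x - b) / a[%R]))%E; last first.
    congr (_ * mu _)%E; apply/funext => z; rewrite /preimage/= /f.
    case: ifP => a1.
      rewrite /= !in_itv/= ltr_pdivrMr// ler_pdivlMr//.
      by rewrite ltrBlDr lerBrDr (mulrC z).
    have a2 : a < 0 by rewrite lt_neqAle a0/= leNgt a1.
    rewrite /= !in_itv/= ler_ndivrMr// ltr_ndivlMr//.
    by rewrite lerBrDr ltrBlDr (mulrC z) andbC.
  case: ifP => a1; rewrite !lebesgue_measure_itv/= !lte_fin.
    rewrite ltr_pM2r ?invr_gt0// ltrD2r; case: ifP => _; last by rewrite mule0.
    by rewrite -!EFinB -EFinM gtr0_norm//; congr (_%:E); field.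
  have a2 : a < 0 by rewrite lt_neqAle a0/= leNgt a1.
  rewrite ltr_nM2r ?invr_lt0// ltrD2r; case: ifP => _; last by rewrite mule0.
  by rewrite -!EFinB -EFinM ltr0_norm//; congr (_%:E); field.
by rewrite E muleA -EFinM mulVf ?mul1e// gt_eqF.
Qed.

(** By Fubini: each vertical section of the preimage is the preimage of a section of [U] under an
    affine map of slope [a], whose offset [g x] does not change lengths. *)
Lemma area_shear (a : R) (g : measurableTypeR R -> R) (U : set (plane R)) :
  a != 0 -> measurable U ->
  area R ((fun Y : plane R => (Y.1, a * Y.2 + g Y.1)) @^-1` U) =
  (`|a|^-1%:E * area R U)%E.
Proof.
move=> a0 mU; rewrite /area /= /product_measure1.
rewrite -ge0_integralZl//; last exact: measurable_fun_xsection.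
apply: eq_integral => x _ /=.
rewrite -(lebesgue_measure_affine (g x) a0); last exact: measurable_xsection.
by congr (mu _); apply/seteqP; split => y /=; rewrite /xsection/= !inE.
Qed.

Lemma area_swap (U : set (plane R)) : measurable U ->
  area R ((fun Y : plane R => (Y.2, Y.1)) @^-1` U) = area R U.
Proof.
move=> mU.
pose s : plane R -> plane R := fun Y => (Y.2, Y.1).
have ms : measurable_fun setT s by exact: measurable_swap.
pose g : {mfun plane R >-> plane R} :=
  HB.pack s (isMeasurableFun.Build _ _ _ _ s ms).
apply/esym.
apply: (@product_measure_unique _ _ _ _ _ mu mu (pushforward (area R) g)) => //.
move=> V W mV mW; transitivity (area R (W `*` V)); last first.
  by rewrite /area /= product_measure1E// muleC.
by congr (area R _); apply/seteqP; split => y /= [].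
Qed.

(** Gaussian elimination: the map is a composite of shears [sh] and coordinate swaps [sw], and the
    shear coefficients multiply to the determinant up to sign. *)
Lemma area_affine (a b c d e f : R) (U : set (plane R)) :
  a * d - b * c != 0 -> measurable U ->
  area R ((fun Y : plane R => (a * Y.1 + b * Y.2 + e, c * Y.1 + d * Y.2 + f))
            @^-1` U) =
  (`|a * d - b * c|^-1%:E * area R U)%E.
Proof.
move=> D0 mU.
pose sw : plane R -> plane R := fun Y => (Y.2, Y.1).
have msw : measurable_fun setT sw by exact: measurable_swap.
pose sh k l m : plane R -> plane R := fun Y => (Y.1, k * Y.2 + (l * Y.1 + m)).
have msh k l m : measurable_fun setT (sh k l m).
  apply/measurable_fun_pairP; split; first exact: measurable_fst.
  apply: measurable_funD; first exact: measurable_funM.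
  by apply: measurable_funD => //; exact: measurable_funM.
have mp (h : plane R -> plane R) V : measurable_fun setT h -> measurable V ->
    measurable (h @^-1` V).
  by move=> mh mV; rewrite -[X in measurable X]setTI; exact: mh.
have shE k l m V : k != 0 -> measurable V ->
    area R (sh k l m @^-1` V) = (`|k|^-1%:E * area R V)%E.
  by move=> k0; exact: (area_shear (fun x => l * x + m) k0).
have msw' V : measurable V -> measurable (sw @^-1` V) by exact: mp.
have msh' k l m V : measurable V -> measurable (sh k l m @^-1` V).
  by apply: mp; exact: msh.
have swE V : measurable V -> area R (sw @^-1` V) = area R V.
  exact: area_swap.
have [b0|b0] := eqVneq b 0.
  have [a0 d0] : a != 0 /\ d != 0.
    by move: D0; rewrite b0 mul0r subr0 mulf_eq0 negb_or => /andP[].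
  set h := (X in X @^-1` _).
  have -> : h @^-1` U = sw @^-1` (sh a 0 e @^-1` (sw @^-1`
      (sh d (c / a) (f - c * e / a) @^-1` U))).
    apply/funext => -[x y]; rewrite /preimage/= /h /sw /sh/= b0.
    by congr (U (_, _)); field.
  rewrite swE; last by auto.
  rewrite shE//; last by auto.
  rewrite swE; last by auto.
  rewrite shE// muleA -EFinM; congr (_%:E * _)%E.
  by rewrite b0 mul0r subr0 normrM invfM.
(* With pivot [b], the first shear produces [a x + b y + e]; after a swap, the second one must add
   this multiple of [x] to obtain [c x + d y + f]. *)
have k0 : c - d * a / b != 0.
  have -> : c - d * a / b = - (a * d - b * c) / b by field.
  by rewrite mulf_neq0 ?oppr_eq0 ?invr_eq0.
set h := (X in X @^-1` _).
have -> : h @^-1` U = sh b a e @^-1` (sw @^-1`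
      (sh (c - d * a / b) (d / b) (f - d * e / b) @^-1` U)).
  apply/funext => -[x y]; rewrite /preimage/= /h /sw /sh/=.
  by congr (U (_, _)); field.
rewrite shE//; last by auto.
rewrite swE; last by auto.
rewrite shE// muleA -EFinM; congr (_%:E * _)%E.
rewrite -invfM -normrM -[in RHS]normrN; congr (`|_|^-1); by field.
Qed.

End AffineMeasure.

(** * Area and arclength seen from O over one side *)

Section ConeMeasure.
Variable R : realType.
Local Notation mu := (@lebesgue_measure R).
Implicit Types (O P Q Y p q w : plane R) (S : set (plane R)).

(** This integral of section lengths is the source of the factor 1/2 in the area of a triangle. *)
Lemma integral_itv01_id : (\int[mu]_(x in `]0%R, 1%R[) x%:E)%E = (2^-1)%:E.
Proof.
rewrite -(@integral_itv_bndoo _ _ _ _ true false); last first.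
  by apply/measurable_EFinP; exact: measurable_id.
have d (x : R) : is_derive x 1 (fun x => 2^-1 * x ^+ 2) x.
  apply: is_derive_eq; rewrite /GRing.scale/=; lra.
rewrite (@continuous_FTC2 _ id (fun x => 2^-1 * x ^+ 2)) //.
- by rewrite expr0n expr1n mulr0 mulr1 -EFinB subr0.
- by apply: continuous_subspaceT => x; exact: cvg_id.
- have c (x : R) : {for x, continuous (fun x : R => 2^-1 * x ^+ 2)}.
    apply: differentiable_continuous; apply/derivable1_diffP.
    by have [] := d x.
  split; first by move=> x _; have [] := d x.
  + exact/cvg_at_right_filter/c.
  + exact/cvg_at_left_filter/c.
- by move=> x _; rewrite derive1E; have [] := d x.
Qed.

Definition det p q : R := p.1 * q.2 - p.2 * q.1.

(* For a triangle [ABC], [dlt] is the inverse of [det (B - A) (C - A)]: whatever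
   the orientation, [dlt * det (B - A) (Y - A)] is then the barycentric
   coordinate of [Y] relative to [C]. *)
Definition cone (dlt : R) p q : set (plane R) :=
  [set w | 0 <= dlt * det p w /\ 0 < dlt * det w q].

Definition cone_triangle (dlt : R) O P Q : set (plane R) :=
  [set Y | cone dlt (P - O) (Q - O) (Y - O) /\
           0 < dlt * det (Q - P) (Y - P)].

(** The parameter 1 is excluded to match [cone], which contains the ray of [p] but not that of [q];
    thus each vertex belongs to one side only. *)
Definition side_params O P Q S : set (measurableTypeR R) :=
  [set s | 0 <= s < 1 /\ S (dir O (P + s *: (Q - P)))].

Lemma measurable_side_params O P Q S : measurable S ->
  measurable (side_params O P Q S).
Proof.
move=> mS.
have m1 : measurable_fun setT (fun s : measurableTypeR R => P + s *: (Q - P)).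
  apply/measurable_fun_pairP; split => /=; apply: measurable_funD => //;
  exact: measurable_funM.
rewrite (_ : side_params _ _ _ _ =
   [set` `[0, 1[%R] `&` (dir O \o (fun s : measurableTypeR R => P + s *: (Q - P))) @^-1` S).
  apply: measurableI; first exact: measurable_itv.
  rewrite -[X in measurable X]setTI.
  exact: (measurableT_comp (measurable_dir O) m1).
by apply/seteqP; split => s; rewrite /side_params/= in_itv/=.
Qed.

Lemma measurable_fun_det (f g : plane R -> plane R) :
  measurable_fun setT f -> measurable_fun setT g ->
  measurable_fun setT (fun Y : plane R => det (f Y) (g Y) : measurableTypeR R).
Proof.
move=> /measurable_fun_pairP[f1 f2] /measurable_fun_pairP[g1 g2].
by apply: measurable_funB; exact: measurable_funM.
Qed.

Lemma measurable_subr P : measurable_fun setT (fun Y : plane R => Y - P).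
Proof.
by apply/measurable_fun_pairP; split; apply: measurable_funB.
Qed.

Lemma measurable_cone dlt p q : measurable (cone dlt p q).
Proof.
have m1 : measurable_fun setT (fun w : plane R => dlt * det p w : measurableTypeR R).
  by apply: measurable_funM => //; exact: measurable_fun_det.
have m2 : measurable_fun setT (fun w : plane R => dlt * det w q : measurableTypeR R).
  by apply: measurable_funM => //; exact: measurable_fun_det.
rewrite (_ : cone _ _ _ = (fun w : plane R => dlt * det p w) @^-1` [set` `[0, +oo[%R]
   `&` (fun w : plane R => dlt * det w q) @^-1` [set` `]0, +oo[%R]).
  apply: measurableI; rewrite -[X in measurable X]setTI.
    by apply: m1 => //; exact: measurable_itv.
  by apply: m2 => //; exact: measurable_itv.
by apply/seteqP; split => w; rewrite /cone/= !in_itv/= !andbT.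
Qed.

Lemma measurable_cone_triangle dlt O P Q : measurable (cone_triangle dlt O P Q).
Proof.
have m1 : measurable_fun setT
    (fun Y : plane R => dlt * det (Q - P) (Y - P) : measurableTypeR R).
  apply: measurable_funM => //; apply: measurable_fun_det => //.
  exact: measurable_subr.
rewrite (_ : cone_triangle _ _ _ _ = (fun Y => Y - O) @^-1` cone dlt (P - O) (Q - O)
   `&` (fun Y : plane R => dlt * det (Q - P) (Y - P)) @^-1` [set` `]0, +oo[%R]).
  apply: measurableI; rewrite -[X in measurable X]setTI.
    by apply: measurable_subr => //; exact: measurable_cone.
  by apply: m1 => //; exact: measurable_itv.
by apply/seteqP; split => w; rewrite /cone_triangle/= !in_itv/= !andbT.
Qed.

Lemma measurable_preimage_dir O S : measurable S -> measurable (dir O @^-1` S).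
Proof.
by move=> mS; rewrite -[X in measurable X]setTI; exact: measurable_dir.
Qed.

Lemma dirZ O (k : R) w : 0 < k -> dir O (O + k *: w) = dir O (O + w).
Proof.
move=> k0; rewrite /dir !(addrC O) !addrK scalerA; congr (_ *: _).
rewrite /enorm/= /GRing.scale/= !exprMn -mulrDr sqrtrM ?sqr_ge0//.
by rewrite sqrtr_sqr gtr0_norm// invfM -mulrA mulrC -mulrA mulfV ?gt_eqF// mulr1.
Qed.

Lemma area_cone_triangle dlt O P Q S :
  0 < dlt * det (P - O) (Q - O) -> measurable S ->
  area R (cone_triangle dlt O P Q `&` dir O @^-1` S) =
  ((`|det (P - O) (Q - O)| / 2)%:E * mu (side_params O P Q S))%E.
Proof.
move=> D0 mS.
have mU : measurable (cone_triangle dlt O P Q `&` dir O @^-1` S).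
  by apply: measurableI; [exact: measurable_cone_triangle|exact: measurable_preimage_dir].
have DE : (P - O).1 * (Q - P).2 - (Q - P).1 * (P - O).2 = det (P - O) (Q - O).
  by rewrite /det/=; ring.
have Dn0 : det (P - O) (Q - O) != 0.
  by apply: contraTneq D0 => ->; rewrite mulr0 ltxx.
(* The coordinates [O + x (P - O) + y (Q - P)]; by [DE] their Jacobian is [det (P - O) (Q - O)]. *)
pose F (Y : plane R) : plane R := ((P - O).1 * Y.1 + (Q - P).1 * Y.2 + O.1,
     (P - O).2 * Y.1 + (Q - P).2 * Y.2 + O.2).
have := @area_affine R (P - O).1 (Q - P).1 (P - O).2 (Q - P).2 O.1 O.2 _ _ mU.
rewrite DE -/F => /(_ Dn0) AE.
have na : 0 < `|det (P - O) (Q - O)| by rewrite normr_gt0.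
have {AE} -> : area R (cone_triangle dlt O P Q `&` dir O @^-1` S) =
  (`|det (P - O) (Q - O)|%:E *
   area R (F @^-1` (cone_triangle dlt O P Q `&` dir O @^-1` S)))%E.
  by rewrite AE muleA -EFinM mulfV ?mul1e// gt_eqF.
rewrite EFinM -muleA; congr (_ * _)%E.
set V := (X in area R X).
have VE : V = [set Y : plane R | (0 < Y.1 < 1) /\ side_params O P Q S (Y.2 / Y.1)].
  apply/funext => -[x y]; rewrite /V /cone_triangle /cone /side_params /preimage/=.
  have FE : F (x, y) = O + x *: (P - O) + y *: (Q - P).
    by rewrite /F; congr (_, _); rewrite /= /GRing.scale/=; ring.
  have -> : det (P - O) (F (x, y) - O) = y * det (P - O) (Q - O).
    by rewrite /det /F/=; ring.
  have -> : det (F (x, y) - O) (Q - O) = (x - y) * det (P - O) (Q - O).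
    by rewrite /det /F/=; ring.
  have -> : det (Q - P) (F (x, y) - P) = (1 - x) * det (P - O) (Q - O).
    by rewrite /det /F/=; ring.
  have dF : 0 < x -> dir O (F (x, y)) = dir O (P + (y / x) *: (Q - P)).
    move=> x0.
    have -> : P + (y / x) *: (Q - P) = O + ((P - O) + (y / x) *: (Q - P)).
      by rewrite addrA (addrC O) subrK.
    rewrite FE -[RHS](dirZ _ _ x0) (scalerDr x (P - O)) scalerA mulrCA mulfV ?gt_eqF//.
    by rewrite mulr1 addrA.
  rewrite !(mulrCA dlt) (pmulr_lge0 _ D0) !(pmulr_lgt0 _ D0) !subr_gt0.
  apply/propext; split.
    move=> [[[y0 yx] x1] FS]; have x0 : 0 < x by exact: le_lt_trans yx.
    rewrite x0 x1; split => //; split; last by rewrite -dF.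
    by rewrite divr_ge0 ?(ltW x0)//= ltr_pdivrMr// mul1r.
  move=> [/andP[x0 x1] [/andP[y0 yx] FS]]; split; last by rewrite dF.
  split=> //; split; last by move: yx; rewrite ltr_pdivrMr// mul1r.
  by move: y0; rewrite pmulr_lge0 ?invr_gt0.
rewrite VE /area /= /product_measure1.
(* The section of [V] at [x] is [side_params] dilated by [x] if [0 < x < 1], and is empty
   otherwise. *)
transitivity (\int[mu]_(x in `]0%R, 1%R[) (x%:E * mu (side_params O P Q S)))%E.
  rewrite [RHS]integral_mkcond; apply: eq_integral => x _.
  rewrite patchE /=; case: ifPn => [|/negP]; rewrite inE/= in_itv/= => x01.
    have x0 : 0 < x by case/andP: x01.
    have := @lebesgue_measure_affine R x^-1 0 (side_params O P Q S).
    rewrite normfV invrK gtr0_norm// => <-; last 2 first.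
    - by rewrite invr_eq0 gt_eqF.
    - exact: measurable_side_params.
    congr (mu _); apply/seteqP; split => y; rewrite /xsection/= inE/= addr0 mulrC.
      by case.
    by split.
  rewrite (_ : xsection _ _ = set0) ?measure0//.
  apply/seteqP; split => y //=; rewrite /xsection/= inE/= => -[x1].
  by rewrite x1 in x01.
rewrite ge0_integralZr//.
- by rewrite integral_itv01_id.
- by move=> x /=; rewrite in_itv/= => /andP[x0 _]; rewrite lee_fin ltW.
Qed.

Lemma arclength_side_dir O P Q S : P != Q -> measurable S ->
  arclength_side P Q (dir O @^-1` S) =
  ((enorm (Q - P))%:E * mu (side_params O P Q S))%E.
Proof.
move=> PQ mS; rewrite /arclength_side /pushforward /mrestr.
set L := enorm _.
have L0 : 0 < L.
  rewrite sqrtr_gt0 lt_neqAle addr_ge0 ?sqr_ge0// andbT eq_sym.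
  rewrite paddr_eq0 ?sqr_ge0// !sqrf_eq0; apply: contraNN PQ.
  rewrite /= !subr_eq0 => /andP[/eqP a /eqP b].
  by apply/eqP; case: (P) (Q) a b => [? ?] [? ?] /= -> ->.
pose E := [set s : measurableTypeR R | 0 <= s < L /\ S (dir O (unit_speed P Q s))].
have ue s : unit_speed P Q (L * s) = P + s *: (Q - P).
  by rewrite /unit_speed /dir -/L scalerA mulrAC mulfV ?gt_eqF// mul1r.
have sE : side_params O P Q S = (fun s => L * s + 0) @^-1` E.
  apply/funext => s; rewrite /side_params /E /preimage/= addr0 ue.
  rewrite pmulr_rge0//; suff -> : (L * s < L) = (s < 1) by [].
  by rewrite -[X in _ < X]mulr1 ltr_pM2l.
have mE : measurable E.
  rewrite (_ : E = [set` `[0, L[%R] `&` unit_speed P Q @^-1` (dir O @^-1` S)).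
    apply: measurableI; first exact: measurable_itv.
    rewrite -[X in measurable X]setTI; apply: measurable_unit_speed => //.
    exact: measurable_preimage_dir.
  by apply/seteqP; split => s; rewrite /E/= in_itv/=.
rewrite sE lebesgue_measure_affine ?gt_eqF// gtr0_norm// muleA -EFinM.
(* [arclength_side] lives on the closed interval from 0 to [L], [E] on the half-open one; they
   differ at most by the null set [[set L]]. *)
rewrite mulfV ?gt_eqF// mul1e; apply/eqP; rewrite eq_le; apply/andP; split.
  rewrite -[leRHS](@measureU0 _ _ _ mu _ [set L])//; last first.
    exact: lebesgue_measure_set1.
  apply: le_measure; rewrite ?inE.
  - apply: measurableI; last exact: measurable_itv.
    rewrite -[X in measurable X]setTI; apply: measurable_unit_speed => //.
    exact: measurable_preimage_dir.
  - exact: measurableU.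
  - move=> s; rewrite /E /= in_itv/= => -[sS /andP[s0]].
    by rewrite le_eqVlt => /orP[/eqP|sL]; [right|left; split => //; apply/andP].
apply: le_measure; rewrite ?inE//.
- apply: measurableI; last exact: measurable_itv.
  rewrite -[X in measurable X]setTI; apply: measurable_unit_speed => //.
  exact: measurable_preimage_dir.
- by move=> s [/andP[s0 sL] sS]; split => //=; rewrite in_itv/= s0 ltW.
Qed.

End ConeMeasure.

(** * Circles tangent to a side *)

Section Tangency.
Variable R : realType.
Implicit Types (A B C O P Q Y p q u v w : plane R).

Definition dot u v : R := u.1 * v.1 + u.2 * v.2.

Lemma plane_eq u v : u.1 = v.1 -> u.2 = v.2 -> u = v.
Proof. by case: u v => [? ?] [? ?] /= -> ->. Qed.

Lemma enorm_ge0 u : 0 <= enorm u. Proof. exact: sqrtr_ge0. Qed.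

Lemma enorm_sqr u : enorm u ^+ 2 = dot u u.
Proof. by rewrite sqr_sqrtr ?addr_ge0 ?sqr_ge0// /dot -!expr2. Qed.

Lemma enorm_gt0 u : u != 0 -> 0 < enorm u.
Proof.
move=> u0; rewrite lt_neqAle enorm_ge0 andbT eq_sym.
apply: contraNN u0 => /eqP u0.
have := enorm_sqr u; rewrite u0 expr0n/= /dot -!expr2 => /esym/eqP.
rewrite paddr_eq0 ?sqr_ge0// !sqrf_eq0 => /andP[/eqP a /eqP b].
by apply/eqP/plane_eq.
Qed.

Lemma cauchy_schwarz u v : - (enorm u * enorm v) <= dot u v.
Proof.
have : `|dot u v| <= enorm u * enorm v.
  rewrite -ler_sqr ?nnegrE ?mulr_ge0 ?enorm_ge0// real_normK ?num_real//.
  rewrite exprMn !enorm_sqr -subr_ge0.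
  (* Lagrange's identity. *)
  have -> : dot u u * dot v v - dot u v ^+ 2 = det u v ^+ 2.
    by rewrite /dot /det; ring.
  exact: sqr_ge0.
by rewrite ler_norml => /andP[].
Qed.

(* A point of the angle (u, v) equidistant from its two sides is on the
   bisector, so that it projects orthogonally inside each side. *)
Lemma dot_bisector_ge0 dlt k u v w : 0 <= k -> dlt * det u v = 1 ->
  0 < dlt * det u w -> 0 < dlt * det w v ->
  `|det u w| = k * enorm u -> `|det w v| = k * enorm v ->
  0 <= dot w u /\ 0 <= dot w v.
Proof.
move=> k0 D1 uw wv Euw Ewv.
have Euw' : dlt * det u w = `|dlt| * k * enorm u.
  by rewrite -[LHS]gtr0_norm// normrM Euw mulrA.
have Ewv' : dlt * det w v = `|dlt| * k * enorm v.
  by rewrite -[LHS]gtr0_norm// normrM Ewv mulrA.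
have CS := cauchy_schwarz u v.
split.
  (* Cramer's rule expands [w] in the basis [(u, v)]; equidistance then makes the Cauchy-Schwarz
     factor [|u| |v| + u.v] appear. *)
  have -> : dot w u = (dlt * det w v) * dot u u + (dlt * det u w) * dot u v.
    by rewrite -[LHS]mul1r -D1 /dot /det; ring.
  rewrite Euw' Ewv' -enorm_sqr (_ : _ + _ =
    `|dlt| * k * enorm u * (enorm u * enorm v + dot u v)); last by ring.
  by rewrite !mulr_ge0 ?enorm_ge0//; lra.
have -> : dot w v = (dlt * det u w) * dot v v + (dlt * det w v) * dot u v.
  by rewrite -[LHS]mul1r -D1 /dot /det; ring.
rewrite Euw' Ewv' -enorm_sqr (_ : _ + _ =
  `|dlt| * k * enorm v * (enorm u * enorm v + dot u v)); last by ring.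
by rewrite !mulr_ge0 ?enorm_ge0//; lra.
Qed.

(** Pythagoras, scaled by the squared length of [PQ]: the vector from [O] to the point splits into a
    part along [PQ], affine in [t], and a normal part given by [det]. *)
Lemma circle_lineE O r P Q t : 0 < r -> P != Q ->
  circle O r ((1 - t) *: P + t *: Q) <->
  (enorm (Q - P) * r) ^+ 2 =
  (enorm (Q - P) ^+ 2 * t + dot (P - O) (Q - P)) ^+ 2
    + det (P - O) (Q - O) ^+ 2.
Proof.
move=> r0 PQ.
have L0 : 0 < enorm (Q - P) by rewrite enorm_gt0// subr_eq0 eq_sym.
set Y := _ + _.
have E : (enorm (Q - P) * enorm (Y - O)) ^+ 2 =
   (enorm (Q - P) ^+ 2 * t + dot (P - O) (Q - P)) ^+ 2
    + det (P - O) (Q - O) ^+ 2.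
  rewrite exprMn !enorm_sqr /dot /det /Y /= /GRing.scale/=; ring.
rewrite /circle/= -E; split; first by move=> ->.
move/eqP; rewrite eqrXn2 ?mulr_ge0 ?enorm_ge0 ?ltW//.
by move=> /eqP/(mulfI (lt0r_neq0 L0)).
Qed.

(** Reflecting the contact point in the foot of the perpendicular from [O] gives another common
    point of circle and line. Uniqueness makes the contact point that foot, so [r] is the distance
    from [O] to the line. *)
Lemma touches_side_det O r P Q : 0 < r -> P != Q -> touches_side O r P Q ->
  `|det (P - O) (Q - O)| = r * enorm (Q - P).
Proof.
move=> r0 PQ [T [CT [t [_ TE]]]].
have L0 : 0 < enorm (Q - P) by rewrite enorm_gt0// subr_eq0 eq_sym.
set L := enorm (Q - P) in L0 *; set m := dot (P - O) (Q - P).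
have cT : circle O r ((1 - t) *: P + t *: Q).
  rewrite -TE; have : (circle O r `&` line P Q) T by rewrite CT.
  by case.
have := cT; rewrite circle_lineE// -/L -/m => E.
(* The other root of the quadratic equation: it changes the sign of [L ^+ 2 * t + m]. *)
pose t' := - t - 2 * m / L ^+ 2.
have E' : (L * r) ^+ 2 = (L ^+ 2 * t' + m) ^+ 2 + det (P - O) (Q - O) ^+ 2.
  rewrite E; congr (_ + _); rewrite /t'; field; exact: lt0r_neq0.
have : (circle O r `&` line P Q) ((1 - t') *: P + t' *: Q).
  by split; [apply/circle_lineE|exists t'].
rewrite CT TE /= => YY.
have tt : t' = t.
  have : (t' - t) *: (Q - P) = 0.
    have : (1 - t') *: P + t' *: Q - ((1 - t) *: P + t *: Q) = 0 by rewrite YY subrr.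
    by move=> <-; apply: plane_eq; rewrite /= /GRing.scale/=; ring.
  by move/eqP; rewrite scaler_eq0 !subr_eq0 (eq_sym Q) (negbTE PQ) orbF => /eqP.
have m0 : L ^+ 2 * t + m = 0.
  have : L ^+ 2 * t' = L ^+ 2 * t by rewrite tt.
  rewrite /t' => /(congr1 (fun x => x / 2)).
  have -> : L ^+ 2 * (- t - 2 * m / L ^+ 2) / 2 = - (L ^+ 2 * t) / 2 - m.
    by field; exact: lt0r_neq0.
  lra.
move: E; rewrite m0 expr0n/= add0r => E.
apply/eqP; rewrite -(@eqrXn2 _ 2)// ?mulr_ge0 ?enorm_ge0 ?ltW//.
by rewrite real_normK ?num_real// mulrC -/L E.
Qed.

(** The contact point is the foot of the perpendicular from [O]; the two signs of [dot] place it
    between [P] and [Q]. *)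
Lemma det_touches_side O r P Q : 0 < r -> P != Q ->
  `|det (P - O) (Q - O)| = r * enorm (Q - P) ->
  0 <= dot (O - P) (Q - P) -> 0 <= dot (O - Q) (P - Q) -> touches_side O r P Q.
Proof.
move=> r0 PQ dE dP dQ.
have L0 : 0 < enorm (Q - P) by rewrite enorm_gt0// subr_eq0 eq_sym.
have L2 : 0 < enorm (Q - P) ^+ 2 by rewrite exprn_gt0.
set L := enorm (Q - P) in dE L0 L2 *; set m := dot (P - O) (Q - P).
have d2 : det (P - O) (Q - O) ^+ 2 = (L * r) ^+ 2.
  by rewrite -real_normK ?num_real// dE mulrC.
pose t := - m / L ^+ 2.
have tE : L ^+ 2 * t + m = 0 by rewrite /t; field; exact: lt0r_neq0.
exists ((1 - t) *: P + t *: Q); split; last first.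
  exists t; split => //; rewrite /t; apply/andP; split.
    apply: divr_ge0; last exact: ltW.
    by rewrite (_ : - m = dot (O - P) (Q - P))// /m /dot/=; ring.
  rewrite ler_pdivrMr// mul1r -subr_ge0.
  rewrite (_ : _ - _ = dot (O - Q) (P - Q))// /L enorm_sqr /m /dot/=; ring.
apply/seteqP; split => [Y [cY [s YE]]|Y ->].
  move: cY; rewrite YE circle_lineE// -/L -/m d2 -[LHS]add0r => /addIr/esym/eqP.
  rewrite sqrf_eq0 -tE => /eqP/addIr/(mulfI (lt0r_neq0 L2)) ->.
  by [].
split; last by exists t.
by apply/circle_lineE => //; rewrite -/L -/m tE expr0n add0r d2.
Qed.

End Tangency.

(** * Barycentric description of the interior *)

Section Interior.
Variable R : realType.
Implicit Types (A B C O P Q T Y p q u v w : plane R).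

Lemma det_eq0_collinear A B C : det (B - A) (C - A) = 0 -> collinear A B C.
Proof.
rewrite /det => /= D.
have lineP X Y : line X Y X by exists 0; rewrite subr0 scale1r scale0r addr0.
have lineQ X Y : line X Y Y by exists 1; rewrite subrr scale1r scale0r add0r.
have [BA|BA] := eqVneq B A; first by exists A, C; rewrite BA; split.
exists A, B; split => //.
have [e1|n1] := eqVneq (B.1 - A.1) 0.
  have n2 : B.2 - A.2 != 0.
    apply: contraNN BA => /eqP e2; apply/eqP/plane_eq; lra.
  exists ((C.2 - A.2) / (B.2 - A.2)); apply: plane_eq; rewrite /= /GRing.scale/=; last by field.
  have e3 : C.1 - A.1 = 0.
    by move: D; rewrite e1 mul0r sub0r => /eqP; rewrite oppr_eq0 mulf_eq0 (negbTE n2) => /eqP.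
  rewrite (_ : C.1 = A.1); last lra.
  by rewrite (_ : B.1 = A.1); [ring|lra].
exists ((C.1 - A.1) / (B.1 - A.1)); apply: plane_eq; rewrite /= /GRing.scale/=; first by field.
have e3 : C.2 - A.2 = (B.2 - A.2) * (C.1 - A.1) / (B.1 - A.1).
  apply: (mulfI n1); rewrite mulrCA mulfV// mulr1; lra.
by rewrite -[LHS](subrK A.2) e3; ring.
Qed.

Lemma triangle_det_ge0 dlt A B C Y : dlt * det (B - A) (C - A) = 1 ->
  triangle A B C Y -> 0 <= dlt * det (B - A) (Y - A).
Proof.
move=> D1 [a [b [c [_ _ c0 abc ->]]]].
have -> : a = 1 - b - c by lra.
rewrite [leRHS](_ : _ = c * (dlt * det (B - A) (C - A))); last first.
  by rewrite /det /= /GRing.scale/=; ring.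
by rewrite D1 mulr1.
Qed.

Lemma triangle_cycle A B C : triangle A B C = triangle B C A.
Proof.
apply/seteqP; split => Y [a [b [c [? ? ? ? ->]]]].
  by exists b, c, a; split => //; [lra|rewrite -addrA addrC].
by exists c, a, b; split => //; [lra|rewrite addrC addrA].
Qed.

Lemma det_cycle A B C : det (C - B) (A - B) = det (B - A) (C - A).
Proof. by rewrite /det /=; ring. Qed.

(* Pushing an interior point slightly away from [C] must not leave the
   half-plane bounded by [AB]. *)
Lemma interior_triangle_det_gt0 dlt A B C Y :
  dlt * det (B - A) (C - A) = 1 ->
  (triangle A B C)° Y -> 0 < dlt * det (B - A) (Y - A).
Proof.
move=> D1 IY; rewrite ltNge; apply/negP => Y0.
pose f (e : R) : plane R :=
  (Y.1 + e * (Y.1 - C.1), Y.2 + e * (Y.2 - C.2)).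
have : \forall e \near 0^'+, triangle A B C (f e).
  have cf : f e @[e --> 0^'+] --> f 0.
    have c (x y : R) : x + e * y @[e --> 0^'+] --> x + 0 * y.
      apply: cvg_at_right_filter; apply: cvgD; first exact: cvg_cst.
      by apply: cvgMr_tmp; exact: cvg_id.
    exact: cvg_pair (c _ _) (c _ _).
  apply: (cf (triangle A B C)).
  by rewrite /f !mul0r !addr0 -surjective_pairing.
move=> nf.
have [e [e0 fe]] : exists e, 0 < e /\ triangle A B C (f e).
  near (0 : R)^'+ => e; exists e.
  by split; near: e; [exact: nbhs_right_gt|exact: nf].
have := triangle_det_ge0 D1 fe.
(* The coordinate relative to [C] is affine and equals 1 at [C], so moving away from [C] lowers
   it. *)
have -> : dlt * det (B - A) (f e - A) =
  (1 + e) * (dlt * det (B - A) (Y - A)) - e * (dlt * det (B - A) (C - A)).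
  by rewrite /det /f /=; ring.
rewrite D1 mulr1 subr_ge0 => H.
have : (1 + e) * (dlt * det (B - A) (Y - A)) <= 0.
  by rewrite mulr_ge0_le0//; lra.
lra.
Unshelve. all: by end_near. Qed.

Lemma continuous_det dlt u P : continuous (fun Y : plane R => dlt * det u (Y - P) : R).
Proof.
move=> Y; apply: cvgM; first exact: cvg_cst.
apply: cvgB; apply: cvgM; try exact: cvg_cst; apply: cvgB; try exact: cvg_cst.
  exact: cvg_snd.
exact: cvg_fst.
Qed.

(** The three quantities are the barycentric coordinates of [Y]; being continuous, they stay
    positive near [Y], which gives the converse. *)
Lemma interior_triangleE dlt A B C Y : dlt * det (B - A) (C - A) = 1 ->
  (triangle A B C)° Y <->
  [/\ 0 < dlt * det (B - A) (Y - A), 0 < dlt * det (C - B) (Y - B) &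
      0 < dlt * det (A - C) (Y - C)].
Proof.
move=> D1; split => [IY|[c0 a0 b0]].
  split; first exact: interior_triangle_det_gt0 IY.
    apply: (@interior_triangle_det_gt0 _ B C A); last by rewrite -triangle_cycle.
    by rewrite det_cycle.
  apply: (@interior_triangle_det_gt0 _ C A B); last by rewrite triangle_cycle.
  by rewrite -det_cycle.
have N u P : 0 < dlt * det u (Y - P) -> \forall Z \near Y, 0 < dlt * det u (Z - P).
  by move=> h; exact: (cvgr_gt _ (@continuous_det dlt u P Y)).
rewrite /interior/=; near=> Z.
exists (dlt * det (C - B) (Z - B)), (dlt * det (A - C) (Z - C)), (dlt * det (B - A) (Z - A)).
split.
- by apply: ltW; near: Z; exact: N.
- by apply: ltW; near: Z; exact: N.
- by apply: ltW; near: Z; exact: N.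
- by rewrite -D1 /det /=; ring.
- apply: plane_eq; rewrite -[LHS]mul1r -D1 /det /= /GRing.scale/=; ring.
Unshelve. all: by end_near. Qed.

End Interior.

(** * The three cones *)

Section Decomposition.
Variable R : realType.
Local Notation mu := (@lebesgue_measure R).
Implicit Types (A B C O P Q T Y p q u v w : plane R).

(* [x], [y], [z] stand for [det p w], [det q w], [det r w], where
   [a p + b q + c r = 0]. *)
Lemma sector_ineq (a b c x y z : R) : 0 < a -> 0 < b -> 0 < c -> a + b + c = 1 ->
  a * x + b * y + c * z = 0 -> 0 <= x -> y < 0 -> 0 < c + y - x ->
  0 < a + z - y /\ 0 < b + x - z.
Proof.
move=> a0 b0 c0 abc E x0 y0 cyx.
(* Multiplied by [c], the two goals become [a (c + y - x) - y] and [b (c + y - x) + x]. *)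
have h1 : 0 < a * (c + y - x) by rewrite mulr_gt0.
have h2 : 0 < b * (c + y - x) by rewrite mulr_gt0.
have e1 : a * y + b * y + c * y = y by rewrite -!mulrDl abc mul1r.
have e2 : a * x + b * x + c * x = x by rewrite -!mulrDl abc mul1r.
split; rewrite -(pmulr_rgt0 _ c0); lra.
Qed.

(** A positive combination of [x], [y], [z] vanishes. Hence, in cyclic order, some nonnegative one
    is followed by a negative one, which selects a cone, or all are zero and [Y = O]. *)
Lemma interior_triangle_cones dlt A B C O : dlt * det (B - A) (C - A) = 1 ->
  (triangle A B C)° O ->
  (triangle A B C)° = cone_triangle dlt O A B `|` cone_triangle dlt O B C
                        `|` cone_triangle dlt O C A `|` [set O].
Proof.
move=> D1 IO; have := IO; rewrite (interior_triangleE _ D1) => -[].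
have -> : det (B - A) (O - A) = det (A - O) (B - O) by rewrite /det/=; ring.
have -> : det (C - B) (O - B) = det (B - O) (C - O) by rewrite /det/=; ring.
have -> : det (A - C) (O - C) = det (C - O) (A - O) by rewrite /det/=; ring.
set c := dlt * _; set a := dlt * _; set b := dlt * _ => c0 a0 b0.
have abc : a + b + c = 1 by rewrite -D1 /a /b /c /det/=; ring.
apply/funext => Y; apply/propext; rewrite (interior_triangleE _ D1).
pose x := dlt * det (A - O) (Y - O); pose y := dlt * det (B - O) (Y - O).
pose z := dlt * det (C - O) (Y - O).
have -> : dlt * det (B - A) (Y - A) = c + y - x.
  by rewrite /c /y /x /det/=; ring.
have -> : dlt * det (C - B) (Y - B) = a + z - y.
  by rewrite /a /z /y /det/=; ring.
have -> : dlt * det (A - C) (Y - C) = b + x - z.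
  by rewrite /b /x /z /det/=; ring.
have E : a * x + b * y + c * z = 0.
  by rewrite /a /b /c /x /y /z /det/=; ring.
have cAB : cone_triangle dlt O A B Y <-> [/\ 0 <= x, y < 0 & 0 < c + y - x].
  rewrite /cone_triangle /cone/= -/x -oppr_lt0 -mulrN.
  have -> : - det (Y - O) (B - O) = det (B - O) (Y - O) by rewrite /det/=; ring.
  have -> : dlt * det (B - A) (Y - A) = c + y - x.
    by rewrite /c /y /x /det/=; ring.
  by split=> [[[]]|[]].
have cBC : cone_triangle dlt O B C Y <-> [/\ 0 <= y, z < 0 & 0 < a + z - y].
  rewrite /cone_triangle /cone/= -/y -oppr_lt0 -mulrN.
  have -> : - det (Y - O) (C - O) = det (C - O) (Y - O) by rewrite /det/=; ring.
  have -> : dlt * det (C - B) (Y - B) = a + z - y.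
    by rewrite /a /z /y /det/=; ring.
  by split=> [[[]]|[]].
have cCA : cone_triangle dlt O C A Y <-> [/\ 0 <= z, x < 0 & 0 < b + x - z].
  rewrite /cone_triangle /cone/= -/z -oppr_lt0 -mulrN.
  have -> : - det (Y - O) (A - O) = det (A - O) (Y - O) by rewrite /det/=; ring.
  have -> : dlt * det (A - C) (Y - C) = b + x - z.
    by rewrite /b /x /z /det/=; ring.
  by split=> [[[]]|[]].
split; last first.
  case=> [[[/cAB|/cBC]|/cCA]|].
  - move=> [x0 y0 h].
    by have [] := sector_ineq a0 b0 c0 abc E x0 y0 h; split.
  - move=> [x0 y0 h]; have bca : b + c + a = 1 by rewrite -abc; ring.
    have E' : b * y + c * z + a * x = 0 by rewrite -E; ring.
    by have [] := sector_ineq b0 c0 a0 bca E' x0 y0 h; split.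
  - move=> [x0 y0 h]; have cab : c + a + b = 1 by rewrite -abc; ring.
    have E' : c * z + a * x + b * y = 0 by rewrite -E; ring.
    by have [] := sector_ineq c0 a0 b0 cab E' x0 y0 h; split.
  - move=> YO; have d0 u : dlt * det u (Y - O) = 0.
      by rewrite YO subrr /det/=; ring.
    by rewrite /x /y /z !d0 !addr0 !subr0.
move=> [hc ha hb].
have [xy|nxy] := boolP ((0 <= x) && (y < 0)).
  by case/andP: xy => *; left; left; left; apply/cAB.
have [xy|nyz] := boolP ((0 <= y) && (z < 0)).
  by case/andP: xy => *; left; left; right; apply/cBC.
have [xy|nzx] := boolP ((0 <= z) && (x < 0)).
  by case/andP: xy => *; left; right; apply/cCA.
right.
(* Without such a sign change the three have the same sign, and [E] excludes that all are
   negative. *)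
have [x0 y0] : x = 0 /\ y = 0.
  have pos (k t : R) : 0 < k -> 0 <= t -> 0 <= k * t by move=> k0; rewrite pmulr_rge0.
  have neg (k t : R) : 0 < k -> t < 0 -> k * t < 0 by move=> k0; rewrite pmulr_rlt0.
  move: nxy nyz nzx; case: (leP 0 x) (leP 0 y) (leP 0 z) => x0 [] y0 [] z0 //= _ _ _.
    have hx := pos _ _ a0 x0; have hy := pos _ _ b0 y0; have hz := pos _ _ c0 z0.
    have /eqP : a * x = 0 by lra.
    rewrite mulf_eq0 gt_eqF//= => /eqP ->; split => //.
    have /eqP : b * y = 0 by lra.
    by rewrite mulf_eq0 gt_eqF//= => /eqP.
  have hx := neg _ _ a0 x0; have hy := neg _ _ b0 y0; have hz := neg _ _ c0 z0.
  lra.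
(* Cramer's rule in the basis [(A - O, B - O)]. *)
have W : c *: (Y - O) = x *: (B - O) - y *: (A - O).
  by apply: plane_eq; rewrite /c /x /y /det /= /GRing.scale/=; ring.
move: W; rewrite x0 y0 !scale0r subr0 => /eqP.
by rewrite scaler_eq0 gt_eqF//= subr_eq0 => /eqP.
Qed.

Lemma cone_disjoint dlt p q r : cone dlt p q `&` cone dlt q r = set0.
Proof.
apply/seteqP; split => w //= [[_ h1] [h2 _]].
have : 0 < dlt * det w q + dlt * det q w by rewrite ltr_wpDr.
by rewrite /det -mulrDr (_ : _ + _ = 0) ?mulr0 ?ltxx//; ring.
Qed.

Lemma set1_plane O : [set O] = [set O.1] `*` [set O.2].
Proof.
apply/seteqP; split => Y /=; first by move=> ->.
by move=> [? ?]; exact: plane_eq.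
Qed.

Lemma measurable_set1_plane O : measurable [set O].
Proof. by rewrite set1_plane; apply: measurableX; exact: measurable_set1. Qed.

Lemma area_set1 O : area R [set O] = 0%E.
Proof.
rewrite set1_plane; transitivity (mu [set O.1] * mu [set O.2])%E.
  by apply: product_measure1E; exact: measurable_set1.
by rewrite lebesgue_measure_set1 mul0e.
Qed.

Lemma area_interior_triangle_dir dlt A B C O S :
  dlt * det (B - A) (C - A) = 1 -> (triangle A B C)° O -> measurable S ->
  area R (dir O @^-1` S `&` (triangle A B C)°) =
   ((`|det (A - O) (B - O)| / 2)%:E * mu (side_params O A B S) +
    (`|det (B - O) (C - O)| / 2)%:E * mu (side_params O B C S) +
    (`|det (C - O) (A - O)| / 2)%:E * mu (side_params O C A S))%E.
Proof.
move=> D1 IO mS; have := IO; rewrite (interior_triangleE _ D1) => -[].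
have -> : det (B - A) (O - A) = det (A - O) (B - O) by rewrite /det/=; ring.
have -> : det (C - B) (O - B) = det (B - O) (C - O) by rewrite /det/=; ring.
have -> : det (A - C) (O - C) = det (C - O) (A - O) by rewrite /det/=; ring.
move=> c0 a0 b0.
rewrite (interior_triangle_cones D1 IO).
have mD := measurable_preimage_dir O mS.
have mK P Q : measurable (cone_triangle dlt O P Q `&` dir O @^-1` S).
  by apply: measurableI => //; exact: measurable_cone_triangle.
have dK P Q T :
    (cone_triangle dlt O P Q `&` dir O @^-1` S) `&`
    (cone_triangle dlt O Q T `&` dir O @^-1` S) = set0.
  apply/seteqP; split => Y //= [[[h1 _] _] [[h2 _] _]].
  have : (cone dlt (P - O) (Q - O) `&` cone dlt (Q - O) (T - O)) (Y - O) by [].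
  by rewrite cone_disjoint.
rewrite setIC !setIUl.
have m0 : measurable ([set O] `&` dir O @^-1` S).
  by apply: measurableI => //; exact: measurable_set1_plane.
(* The point [O], where [dir O] takes the default value 0, has area zero. *)
rewrite measureU0//; last 2 first.
- by apply: measurableU => //; exact: measurableU.
- apply: (@subset_measure0 _ _ _ _ _ [set O]) => //; last exact: area_set1.
  exact: measurable_set1_plane.
rewrite measureU//; last 2 first.
- exact: measurableU.
- by rewrite setIUl [X in X `|` _]setIC !dK setU0.
rewrite -(area_cone_triangle c0 mS) -(area_cone_triangle a0 mS).
by rewrite -(area_cone_triangle b0 mS) measureU.
Qed.

End Decomposition.

(** * The two distributions *)

Section Distributions.
Variable R : realType.
Local Notation mu := (@lebesgue_measure R).
Implicit Types (A B C O P Q T Y p q u v w : plane R).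

(** On measurable [S], this is the law of the direction of a uniform point of the side [PQ], taken
    in [R] so that weighted averages are computed in a field. *)
Definition side_frac O P Q S : R := fine (mu (side_params O P Q S)).

Lemma side_fracE O P Q S : measurable S ->
  mu (side_params O P Q S) = (side_frac O P Q S)%:E.
Proof.
move=> mS; rewrite /side_frac fineK// ge0_fin_numE ?measure_ge0//.
apply: (@le_lt_trans _ _ (mu [set` `[0%R, 1%R[])); last first.
  by rewrite lebesgue_measure_itv/= lte_fin ltr01 ltry.
apply: le_measure; rewrite ?inE; [exact: measurable_side_params|exact: measurable_itv|].
by move=> s [s01 _] /=; rewrite in_itv.
Qed.

Lemma side_frac_full O P Q S : (forall s, 0 <= s < 1 -> S (dir O (P + s *: (Q - P)))) ->
  side_frac O P Q S = 1.
Proof.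
move=> sS; rewrite /side_frac (_ : side_params _ _ _ _ = [set` `[0, 1[%R]).
  by rewrite lebesgue_measure_itv/= lte_fin ltr01 oppr0 adde0.
apply/seteqP; split => s /=; rewrite in_itv/=; first by case.
by move=> s01; split => //; exact: sS.
Qed.

Lemma side_frac_empty O P Q S : (forall s, 0 <= s < 1 -> ~ S (dir O (P + s *: (Q - P)))) ->
  side_frac O P Q S = 0.
Proof.
move=> sS; rewrite /side_frac (_ : side_params _ _ _ _ = set0) ?measure0//.
by apply/seteqP; split => s //= [/sS].
Qed.

Lemma distribution_mnormalize d d' (T : measurableType d) (T' : measurableType d')
    (m : {measure set T -> \bar R}) (P : probability T R)
    (X : {mfun T >-> T'}) (M : R) U : 0 < M -> m setT = M%:E ->
  distribution (mnormalize m P) X U = (m (X @^-1` U) * M^-1%:E)%E.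
Proof.
move=> M0 mT; rewrite /distribution /pushforward /= /mnormalize mT.
by rewrite eqe gt_eqF.
Qed.

Definition side_average (a b c : R) A B C O S : R :=
  (a * side_frac O A B S + b * side_frac O B C S + c * side_frac O C A S)
    / (a + b + c).

Lemma distribution_boundary A B C O S : A != B -> B != C -> C != A ->
  measurable S ->
  distribution (uniform_boundary A B C) (dir O) S =
  (side_average (enorm (B - A)) (enorm (C - B)) (enorm (A - C)) A B C O S)%:E.
Proof.
move=> AB BC CA mS.
have L0 P Q : P != Q -> 0 < enorm (Q - P).
  by move=> PQ; rewrite enorm_gt0// subr_eq0 eq_sym.
have E V : measurable V -> arclength_boundary A B C (dir O @^-1` V) =
  (enorm (B - A) * side_frac O A B V + enorm (C - B) * side_frac O B C V +
   enorm (A - C) * side_frac O C A V)%:E.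
  move=> mV; rewrite [LHS]measure_addE [X in (X + _)%E]measure_addE.
  by rewrite !EFinD !EFinM -!side_fracE// -!arclength_side_dir.
rewrite (@distribution_mnormalize _ _ _ _ _ _ _ (enorm (B - A) + enorm (C - B) + enorm (A - C))).
- by rewrite E// -EFinM.
- by rewrite !addr_gt0// L0.
- by rewrite -(preimage_setT (dir O)) E// !side_frac_full// !mulr1.
Qed.

Lemma distribution_interior dlt A B C O S :
  dlt * det (B - A) (C - A) = 1 -> (triangle A B C)° O -> measurable S ->
  distribution (uniform_interior A B C) (dir O) S =
  (side_average `|det (A - O) (B - O)| `|det (B - O) (C - O)|
                `|det (C - O) (A - O)| A B C O S)%:E.
Proof.
move=> D1 IO mS.
set a := `|det (A - O) _|; set b := `|det (B - O) _|; set c := `|det (C - O) _|.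
have E V : measurable V -> area R (dir O @^-1` V `&` (triangle A B C)°) =
  ((a * side_frac O A B V + b * side_frac O B C V + c * side_frac O C A V) / 2)%:E.
  move=> mV; rewrite (area_interior_triangle_dir D1)// !side_fracE//.
  rewrite -!EFinM -!EFinD; congr (_%:E); rewrite -/a -/b -/c; ring.
have a0 : 0 < a.
  have := IO; rewrite (interior_triangleE _ D1) => -[+ _ _].
  rewrite (_ : det _ (O - A) = det (A - O) (B - O)); last by rewrite /det/=; ring.
  by move=> h; rewrite normr_gt0; apply: contraTneq h => ->; rewrite mulr0 ltxx.
have abc0 : 0 < a + b + c by rewrite !ltr_wpDr// normr_ge0.
rewrite (@distribution_mnormalize _ _ _ _ _ _ _ ((a + b + c) / 2)).
(* The factor 1/2 occurs in both the area and the total mass, and cancels. *)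
- rewrite /= /mrestr E// -EFinM; congr (_%:E); rewrite /side_average.
  by field; exact: lt0r_neq0.
- by rewrite divr_gt0.
- by rewrite /= /mrestr -(preimage_setT (dir O)) E// !side_frac_full// !mulr1.
Qed.

(** * Cones of directions as test sets *)

Lemma coneZ dlt (k : R) p q w : 0 < k -> cone dlt p q (k *: w) <-> cone dlt p q w.
Proof.
move=> k0; rewrite /cone/=.
have -> : det p (k *: w) = k * det p w by rewrite /det /= /GRing.scale/=; ring.
have -> : det (k *: w) q = k * det w q by rewrite /det /= /GRing.scale/=; ring.
by rewrite !(mulrCA dlt) pmulr_rge0// pmulr_rgt0.
Qed.

Lemma cone_dir dlt p q O Y : cone dlt p q (dir O Y) <-> cone dlt p q (Y - O).
Proof.
(* At [Y = O] both sides test the zero vector. *)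
rewrite /dir; have [->|Y0] := eqVneq (Y - O) 0; first by rewrite scaler0.
by apply: coneZ; rewrite invr_gt0 enorm_gt0.
Qed.

(** This is the mutual singularity of the three side laws: testing a mixture of them on this cone
    extracts the weight of [PQ]. *)
Lemma side_frac_cone dlt O P Q T :
  0 < dlt * det (P - O) (Q - O) -> 0 < dlt * det (Q - O) (T - O) ->
  0 < dlt * det (T - O) (P - O) ->
  let S := cone dlt (P - O) (Q - O) in
  [/\ side_frac O P Q S = 1, side_frac O Q T S = 0 & side_frac O T P S = 0].
Proof.
move=> pq qt tp S; split.
- apply: side_frac_full => s /andP[s0 s1]; apply/cone_dir; split.
    rewrite (_ : _ * _ = s * (dlt * det (P - O) (Q - O))).
      by rewrite mulr_ge0// ltW.
    by rewrite /det /= /GRing.scale/=; ring.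
  rewrite (_ : _ * _ = (1 - s) * (dlt * det (P - O) (Q - O))).
    by rewrite mulr_gt0// subr_gt0.
  by rewrite /det /= /GRing.scale/=; ring.
- apply: side_frac_empty => s /andP[s0 s1] /cone_dir[_].
  rewrite (_ : _ * _ = - (s * (dlt * det (Q - O) (T - O)))).
    by rewrite oppr_gt0 ltNge mulr_ge0// ltW.
  by rewrite /det /= /GRing.scale/=; ring.
- apply: side_frac_empty => s /andP[s0 s1] /cone_dir[+ _].
  rewrite (_ : _ * _ = - ((1 - s) * (dlt * det (T - O) (P - O)))).
    by rewrite oppr_ge0 leNgt mulr_gt0// subr_gt0.
  by rewrite /det /= /GRing.scale/=; ring.
Qed.

(** [|det (P - O) (Q - O)|] is the length of [PQ] times the distance from [O] to its line, so the
    common ratio is the inradius. Conversely, at each vertex [dot_bisector_ge0] keeps the contact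
    points on the sides. *)
Lemma incenter_proportional dlt A B C O :
  dlt * det (B - A) (C - A) = 1 -> (triangle A B C)° O ->
  A != B -> B != C -> C != A ->
  is_incenter A B C O <->
  exists2 r, 0 < r &
    [/\ `|det (A - O) (B - O)| = r * enorm (B - A),
        `|det (B - O) (C - O)| = r * enorm (C - B) &
        `|det (C - O) (A - O)| = r * enorm (A - C)].
Proof.
move=> D1 IO AB BC CA; split.
  by move=> [r [r0 tAB tBC tCA]]; exists r => //; split; exact: touches_side_det.
move=> [r r0 [dAB dBC dCA]]; exists r.
have := IO; rewrite (interior_triangleE _ D1) => -[hAB hBC hCA].
have r0' := ltW r0.
have dotP P Q T : dlt * det (Q - P) (T - P) = 1 ->
    0 < dlt * det (Q - P) (O - P) -> 0 < dlt * det (P - T) (O - T) ->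
    `|det (P - O) (Q - O)| = r * enorm (Q - P) ->
    `|det (T - O) (P - O)| = r * enorm (P - T) ->
    0 <= dot (O - P) (Q - P) /\ 0 <= dot (O - P) (T - P).
  move=> E h1 h2 e1 e2.
  apply: (dot_bisector_ge0 r0' E) => //.
  - by rewrite (_ : det _ _ = det (P - T) (O - T))// /det/=; ring.
  - by rewrite -e1; congr (`|_|); rewrite /det/=; ring.
  - rewrite (_ : enorm (T - P) = enorm (P - T)).
      by rewrite -e2; congr (`|_|); rewrite /det/=; ring.
    by rewrite /enorm/=; congr (Num.sqrt _); ring.
have [AdB AdC] := dotP A B C D1 hAB hCA dAB dCA.
have [BdC BdA] := dotP B C A (etrans (congr1 _ (det_cycle _ _ _)) D1) hBC hAB dBC dAB.
have D1' : dlt * det (A - C) (B - C) = 1 by rewrite -D1 -det_cycle.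
have [CdA CdB] := dotP C A B D1' hCA hBC dCA dBC.
by split => //; exact: det_touches_side.
Qed.

End Distributions.

(** * Equality of the two laws as proportionality of their weights *)

Theorem corollary2p3 (R : realType) (A B C O : plane R)
    (ABC_nondegenerate : ~ collinear A B C)
    (O_interior : (triangle A B C)° O) :
  is_incenter A B C O <->
  forall S : set (plane R), measurable S ->
    distribution (uniform_interior A B C) (dir O) S =
    distribution (uniform_boundary A B C) (dir O) S.
Proof.
have D0 : det (B - A) (C - A) != 0.
  by apply/eqP => /det_eq0_collinear.
have D1 : (det (B - A) (C - A))^-1 * det (B - A) (C - A) = 1 by rewrite mulVf.
set dlt := _^-1 in D1.
have AB : A != B.
  by apply: contra_neq D0 => ->; rewrite subrr /det/=; ring.
have BC : B != C.
  by apply: contra_neq D0 => ->; rewrite /det/=; ring.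
have CA : C != A.
  by apply: contra_neq D0 => ->; rewrite subrr /det/=; ring.
rewrite (incenter_proportional D1)//; split => [[r r0 [dAB dBC dCA]] S mS|H].
  rewrite (distribution_interior D1)// distribution_boundary//; congr (_%:E).
  (* The common ratio [r] cancels between the weights and their sum. *)
  rewrite /side_average dAB dBC dCA -!mulrA -!mulrDr invfM.
  by rewrite mulrACA mulfV ?mul1r// gt_eqF.
have := O_interior; rewrite (interior_triangleE _ D1) => -[].
have -> : det (B - A) (O - A) = det (A - O) (B - O) by rewrite /det/=; ring.
have -> : det (C - B) (O - B) = det (B - O) (C - O) by rewrite /det/=; ring.
have -> : det (A - C) (O - C) = det (C - O) (A - O) by rewrite /det/=; ring.
move=> hAB hBC hCA.
have n0 P Q : 0 < dlt * det (P - O) (Q - O) -> 0 < `|det (P - O) (Q - O)|.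
  by move=> h; rewrite normr_gt0; apply: contraTneq h => ->; rewrite mulr0 ltxx.
have L0 P Q : P != Q -> 0 < enorm (Q - P).
  by move=> PQ; rewrite enorm_gt0// subr_eq0 eq_sym.
set D := `|det (A - O) (B - O)| + `|det (B - O) (C - O)| + `|det (C - O) (A - O)|.
set L := enorm (B - A) + enorm (C - B) + enorm (A - C).
have Dp : 0 < D by rewrite !addr_gt0// n0.
have Lp : 0 < L by rewrite !addr_gt0// L0.
(* Only the cones over the sides are needed as test sets; each one equates the normalized weights of
   its side. *)
have {}H P Q : side_average `|det (A - O) (B - O)| `|det (B - O) (C - O)|
    `|det (C - O) (A - O)| A B C O (cone dlt (P - O) (Q - O)) =
  side_average (enorm (B - A)) (enorm (C - B)) (enorm (A - C)) A B C O
    (cone dlt (P - O) (Q - O)).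
  have mS := measurable_cone dlt (P - O) (Q - O).
  by have := H _ mS; rewrite (distribution_interior D1)// distribution_boundary// => -[].
have solve (x y : R) : x / D = y / L -> x = D / L * y.
  by move=> h; rewrite -[LHS](divfK (lt0r_neq0 Dp)) h; ring.
(* The ratio of the total weights must be the common ratio. *)
exists (D / L); first exact: divr_gt0.
split; apply: solve.
- have [e1 e2 e3] := side_frac_cone hAB hBC hCA.
  by move: (H A B); rewrite /side_average e1 e2 e3 !mulr0 !addr0 !mulr1.
- have [e1 e2 e3] := side_frac_cone hBC hCA hAB.
  by move: (H B C); rewrite /side_average e1 e2 e3 !mulr0 !addr0 !add0r !mulr1.
- have [e1 e2 e3] := side_frac_cone hCA hAB hBC.
  by move: (H C A); rewrite /side_average e1 e2 e3 !mulr0 !addr0 !add0r !mulr1.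
Qed.
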